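(* Let $\mathbb{P}$ be a projective geometry, $\mathbb{P}'$ a hyperplane of $\mathbb{P}$, $\Delta$ a nonempty simple graph with node set $N$, $\mathbf{z}':E(\Delta)\to\mathbb{P}'$ a projective representation of the graphic matroid $G(\Delta)$, and $\hat e_0\in\mathbb{P}\setminus\mathbb{P}'$. Let $\hat E\subseteq\hat E(\Delta,\hat e_0)\setminus\{\hat e_0\}$. Then $\Omega_0(\hat E)$ is a biased graph, and its extended lift matroid satisfies $L_0(\Omega_0(\hat E))\cong M(\hat E\cup\{\hat e_0\})$ via $e\mapsto\hat e$, $e_0\mapsto\hat e_0$.
   Context: A projective representation of $G(\Delta)$ is an injective map such that a set of edges is independent in the graphic (cycle) matroid of $\Delta$ iff its image is projectively independent. The edge lines are the lines $\mathbf{z}'(f)\hat e_0$ for $f\in E(\Delta)$, and $\hat E(\Delta,\hat e_0)$ is their union. $\Omega_0(\hat E)$: node set $N$; one edge $e$ for each point $\hat e\in\hat E$; $\hat e$ lies on a unique edge line $\mathbf{z}'(f)\hat e_0$, and $e$ is a link with the same endpoints as $f$. A cross-flat is a flat of $\mathbb{P}$ not containing $\hat e_0$; a circle $C$ is balanced iff $\hat C$ spans a cross-flat. A biased graph: no theta subgraph (three internally disjoint paths with common endpoints) contains exactly two balanced circles. An edge set is balanced if all its circles are balanced. The extended lift matroid $L_0(\Omega)$ has ground set $E\cup\{e_0\}$ and, for finite $S$, rank $\#N(S)-c(S)$ if $S\subseteq E$ is balanced and $\#N(S)-c(S)+1$ if $S$ is unbalanced or contains $e_0$, where $N(S)$ is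 the set of endpoints of edges in $S\cap E$ and $c(S)$ the number of components of $(N(S),S\cap E)$. $M(X)$ denotes the matroid of projective dependence on a point set $X$. *)

(* Defs.v *)
From HB Require Import structures.
From mathcomp Require Import all_boot finmap.
From mathcomp Require Import boolp classical_sets functions.

Set Implicit Arguments.
Unset Strict Implicit.
Unset Printing Implicit Defensive.

Local Open Scope classical_set_scope.

(* Synthetic projective geometry of arbitrary, possibly infinite, dimension;
   neither Desargues' theorem nor any coordinatization is assumed. *)
Record projGeom := ProjGeom {
  pt :> choiceType;
  is_line : set (set pt);
  line_ex : forall p q : pt, p != q -> exists l, [/\ is_line l, l p & l q];
  line_uniq : forall (p q : pt) (l m : set pt), p != q ->
    is_line l -> is_line m -> l p -> l q -> m p -> m q -> l = m;
  veblen : forall (a b c d : pt) (ab cd ac bd : set pt), uniq [:: a; b; c; d] ->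
    [/\ is_line ab, ab a & ab b] -> [/\ is_line cd, cd c & cd d] ->
    [/\ is_line ac, ac a & ac c] -> [/\ is_line bd, bd b & bd d] ->
    ab `&` cd !=set0 -> ac `&` bd !=set0;
  line_thick : forall l, is_line l ->
    exists p q r : pt, [/\ uniq [:: p; q; r], l p, l q & l r]
}.

Section Geometry.
Variable P : projGeom.
Implicit Types (F H A : set P) (p q x : P).

(* Meant for [p != q]; it is then the unique line containing [p] and [q]. *)
Definition line_through p q : set P :=
  \bigcup_(l in [set l | [/\ is_line l, l p & l q]]) l.

Definition flat F := forall p q, p != q -> F p -> F q -> line_through p q `<=` F.

Definition span A : set P := \bigcap_(F in [set F | flat F /\ A `<=` F]) F.

Definition hyperplane H := [/\ flat H, H <> setT &
  forall F, flat F -> H `<=` F -> F = H \/ F = setT].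

Definition proj_indep A := forall x, A x -> ~ span (A `\ x) x.

Definition proj_rank (S : {fset P}) : nat :=
  \max_(A <- fpowerset S | `[< proj_indep [set` A] >]) #|` A|%fset.

Definition cross_flat (e0 : P) F := flat F /\ ~ F e0.

End Geometry.

(* Possibly infinite graphs; parallel edges and loops are allowed.  [ends e] is
   the set of endpoints of [e], a singleton when [e] is a loop. *)
Record graph := Graph {
  node : choiceType;
  edge : choiceType;
  ends : edge -> {fset node};
  ends_card : forall e, 0 < #|` ends e|%fset <= 2
}.

Section Graphs.
Variable G : graph.
Implicit Types (u v : node G) (s t : seq (edge G * node G)) (S T : {fset edge G}).

Definition is_simple := (forall e : edge G, #|` ends e|%fset = 2) /\ injective (@ends G).

(* [s] lists the edges of a walk from [u], each with the node it leads to. *)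
Fixpoint is_walk u s : bool :=
  if s is (e, v) :: s' then (ends e == [fset u; v]%fset) && is_walk v s' else true.

Definition walk_edges s : {fset edge G} := [fset e in unzip1 s]%fset.

Definition walk_end u s : node G := last u (unzip2 s).

Definition is_path u v s :=
  [/\ is_walk u s, walk_end u s = v & uniq (u :: unzip2 s)].

(* This covers loops (length 1) and pairs of parallel edges (length 2). *)
Definition is_circle S := exists u s,
  [/\ s != [::], is_walk u s, walk_end u s = u,
      uniq (unzip2 s) && uniq (unzip1 s) & S = walk_edges s].

(* For paths [s] and [t] with common final node [v] and common initial node. *)
Definition internally_disjoint v s t :=
  (forall e, e \in unzip1 s -> e \notin unzip1 t) /\
  (forall w, w \in unzip2 s -> w \in unzip2 t -> w = v).

Definition is_theta T := exists u v s1 s2 s3,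
  [/\ u != v,
      [/\ is_path u v s1, is_path u v s2 & is_path u v s3],
      [/\ internally_disjoint v s1 s2, internally_disjoint v s1 s3
        & internally_disjoint v s2 s3]
    & T = (walk_edges s1 `|` walk_edges s2 `|` walk_edges s3)%fset].

Definition graphic_indep (A : set (edge G)) :=
  forall S, is_circle S -> ~ [set` S] `<=` A.

Definition nodes_of S : {fset node G} := (\bigcup_(e <- S) ends e)%fset.

Definition adj S : rel (nodes_of S) :=
  fun x y => has (fun e => ends e == [fset val x; val y]%fset) S.

Definition ncomp S : nat := n_comp (@adj S) predT.

End Graphs.

(* A graph with a distinguished class of circles; [is_biased] is the
   requirement making it a biased graph. *)
Record circleGraph := CircleGraph {
  cgraph :> graph;
  balanced_circle : set {fset edge cgraph};
  balanced_circleP : forall C, balanced_circle C -> is_circle C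
}.

Definition is_biased (O : circleGraph) := forall T : {fset edge O}, is_theta T ->
  #|` [fset C in fpowerset T | `[< balanced_circle C >]]|%fset <> 2.

Definition balanced (O : circleGraph) (S : {fset edge O}) :=
  forall C : {fset edge O}, (C `<=` S)%fset -> is_circle C -> balanced_circle C.

(* Finitary matroids are presented by the ranks of finite subsets of the ground
   set; [is_matroid] consists of Whitney's rank axioms. *)
Record rankSystem (T : choiceType) := RankSystem {
  ground : set T;
  rk : {fset T} -> nat
}.

Definition is_matroid (T : choiceType) (M : rankSystem T) :=
  rk M fset0 = 0 /\
  forall S : {fset T}, [set` S] `<=` ground M ->
    (forall x, ground M x ->
      rk M S <= rk M (x |` S)%fset <= (rk M S).+1) /\
    (forall x y, ground M x -> ground M y ->
      rk M (x |` S)%fset = rk M S -> rk M (y |` S)%fset = rk M S ->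
      rk M (x |` (y |` S))%fset = rk M S).

Definition matroid_iso (T U : choiceType) (M : rankSystem T) (M' : rankSystem U)
    (f : T -> U) :=
  set_bij (ground M) (ground M') f /\
  forall S : {fset T}, [set` S] `<=` ground M ->
    rk M' [fset f x | x in S]%fset = rk M S.

Definition proj_matroid (P : projGeom) (X : set P) : rankSystem P :=
  RankSystem X (@proj_rank P).

Section ExtendedLift.
Variable O : circleGraph.

Definition edge_part (S : {fset option (edge O)}) : {fset edge O} :=
  [fset e in pmap id S]%fset.

Definition lift_rank (S : {fset option (edge O)}) : nat :=
  #|` nodes_of (edge_part S)|%fset - ncomp (edge_part S)
  + ~~ `[< balanced (edge_part S) /\ None \notin S >].

(* [None] is the extra point e_0. *)
Definition ext_lift_matroid : rankSystem (option (edge O)) :=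
  RankSystem setT lift_rank.

End ExtendedLift.

Section EdgeLines.
Variables (P : projGeom) (D : graph) (z : edge D -> P) (e0 : P).

Definition proj_repr := injective z /\
  forall A : set (edge D), graphic_indep A <-> proj_indep (z @` A).

Definition edge_line (f : edge D) : set P := line_through (z f) e0.

Definition edge_lines : set P := \bigcup_f edge_line f.

Variables (X : set P) (hX : X `<=` edge_lines `\ e0).

Lemma foot_ex (e : X) : exists f, edge_line f (val e).
Proof. by have [[f _ ?] _] := hX (set_mem (valP e)); exists f. Qed.

(* An edge whose edge line carries the point [e]; unique by [foot_uniq]. *)
Definition foot (e : X) : edge D := sval (cid (foot_ex e)).

Definition Omega0_graph : graph :=
  Graph (fun e : X => ends_card (foot e)).

Definition Omega0_balanced : set {fset edge Omega0_graph} :=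
  [set C : {fset edge Omega0_graph} |
  is_circle C /\ cross_flat e0 (span [set val (e : X) | e in [set` C]])].

Lemma Omega0_balancedP C : Omega0_balanced C -> is_circle C.
Proof. by case. Qed.

Definition Omega0 : circleGraph := CircleGraph Omega0_balancedP.

End EdgeLines.

Lemma foot_uniq (P : projGeom) (H : set P) (D : graph) (z : edge D -> P)
    (e0 : P) (X : set P) (hX : X `<=` edge_lines z e0 `\ e0) (e : X) f :
  hyperplane H -> (forall f, H (z f)) -> injective z -> ~ H e0 ->
  edge_line z e0 f (val e) -> foot hX e = f.
Proof.
move=> [Hf _ _] zH zinj e0H; have := svalP (cid (foot_ex hX e)).
rewrite -/(foot hX e); move: (foot hX e) => g [l [ll lg l0] le] [m [lm mf m0] me].
have ne : val e != e0.
  by have [_ /= ne] := hX _ (set_mem (valP e)); apply/eqP.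
have elm : m = l by apply: (line_uniq ne).
apply: zinj; apply: contra_notP e0H => /eqP ngf.
by apply: (Hf _ _ ngf) => //; exists l => //; split => //; rewrite -elm.
Qed.

(* Main.v *)
(* Projecting from the apex e0 sends a point of an edge line to the representing
   point z f of its edge.  If F is a spanning forest of a finite set S of edges, the
   projections of F are independent in the hyperplane, so F together with e0 is
   independent, and it spans S: hence S and e0 have rank #F + 1, while S itself has
   rank #F or #F + 1 according as e0 lies outside its span or not.  When every circle
   of S spans a cross-flat, each edge of S outside F completes a circle with F, and
   exchange puts it in the span of F alone; so S is balanced exactly when e0 is not in
   its span.  Two balanced circles of a theta graph T bring its rank down to #T - 2,
   the rank of its spanning forest, so T and with it all three circles are balanced. *)
Require Import Defs.
From HB Require Import structures.
From mathcomp Require Import all_boot finmap.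
From mathcomp Require Import boolp classical_sets functions.

Set Implicit Arguments.
Unset Strict Implicit.
Unset Printing Implicit Defensive.

Local Open Scope classical_set_scope.

(** * Spans, exchange and rank in a projective geometry *)

Section Span.
Variable P : projGeom.
Implicit Types (F A B : set P) (p q x y : P).

Lemma sub_span A : A `<=` span A.
Proof. by move=> x Ax F [_ AF]; exact: AF. Qed.

Lemma span_min A F : flat F -> A `<=` F -> span A `<=` F.
Proof. by move=> fF AF x; apply. Qed.

Lemma flat_span A : flat (span A).
Proof.
move=> p q pq Ap Aq x pqx F [fF AF].
by apply: (fF p q pq) => //; [apply: Ap | apply: Aq].
Qed.

Lemma span_sub A B : A `<=` span B -> span A `<=` span B.
Proof. by apply: span_min; exact: flat_span. Qed.

Lemma spanS A B : A `<=` B -> span A `<=` span B.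
Proof. by move=> AB; apply: span_sub => x /AB; exact: sub_span. Qed.

Lemma line_throughl p q : p != q -> line_through p q p.
Proof. by move=> /line_ex [l [ll lp lq]]; exists l. Qed.

Lemma line_throughr p q : p != q -> line_through p q q.
Proof. by move=> /line_ex [l [ll lp lq]]; exists l. Qed.

Lemma is_line_through p q : p != q -> is_line (line_through p q).
Proof.
move=> pq; have [l [ll lp lq]] := line_ex pq.
suff -> : line_through p q = l by [].
apply/seteqP; split=> x; last by exists l.
by case=> m [lm mp mq] mx; rewrite (line_uniq pq ll lm).
Qed.

Lemma line_throughC p q : line_through p q = line_through q p.
Proof. by apply/seteqP; split=> x [l [ll lp lq] lx]; exists l. Qed.

Lemma line_throughP p q : p != q ->
  [/\ is_line (line_through p q), line_through p q p & line_through p q q].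
Proof.
by move=> pq; split; [exact: is_line_through|exact: line_throughl|exact: line_throughr].
Qed.

Lemma line_through_eq p q x y : p != q -> x != y ->
  line_through p q x -> line_through p q y -> line_through p q = line_through x y.
Proof.
move=> pq xy lx ly; apply: (line_uniq xy) => //; try exact: is_line_through.
  exact: line_throughl.
exact: line_throughr.
Qed.

(** For a flat [F] missing [x] this is the join of [F] and [x]. The clause [y = x] keeps the apex in
    when [F] is empty. *)
Definition cone F x : set P := [set y | y = x \/ exists2 p, F p & line_through p x y].

Lemma coneF F x p : ~ F x -> F p -> cone F x p.
Proof.
move=> Fx Fp; right; exists p => //; apply: line_throughl.
by apply: contra_notN Fx => /eqP <-.
Qed.

(* Veblen's axiom for the lines [x p] and [w q], which meet in [y]. *)
Lemma cone_join F x y q w : flat F -> ~ F x -> cone F x y -> F q -> y != q ->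
  line_through y q w -> cone F x w.
Proof.
move=> fF Fx cy Fq yq yqw.
have nex p : F p -> p != x by move=> Fp; apply: contra_notN Fx => /eqP <-.
have [->|wx] := eqVneq w x; first by left.
case: cy => [yx|[p Fp pxy]]; first by right; exists q => //; rewrite line_throughC -yx.
have [wF|wF] := pselect (F w); first exact: coneF.
have [pq|pq] := eqVneq p q.
  right; exists p => //; rewrite (line_through_eq (nex p Fp) yq) // pq.
  by apply: line_throughl; rewrite nex.
have wq : w != q by apply: contra_notN wF => /eqP ->.
have wp : w != p by apply: contra_notN wF => /eqP ->.
have [t [xwt pqt]] : line_through x w `&` line_through p q !=set0.
  have px := nex _ Fp; have qx := nex _ Fq.
  apply: (@veblen P x p w q (line_through x p) (line_through w q)).
  - by rewrite /= !inE !negb_or pq wq (eq_sym x p) px (eq_sym x w) wx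
        (eq_sym x q) qx (eq_sym p w) wp.
  - by apply: line_throughP; rewrite eq_sym.
  - exact: line_throughP.
  - by apply: line_throughP; rewrite eq_sym.
  - exact: line_throughP.
  exists y; split; first by rewrite line_throughC.
  rewrite -(line_through_eq yq wq) //; [exact: line_throughl|exact: line_throughr].
have Ft : F t by exact: (fF p q).
right; exists t => //; rewrite line_throughC in xwt.
have xtn : t != x by exact: nex.
rewrite -(line_through_eq wx xtn) //; [exact: line_throughl|exact: line_throughr].
Qed.

(** Let [w] lie on the line [y1 y2], with [y2] on the line from [x] to a point [p2] of [F]. In the
    general case the lines [x p2] and [w y1] meet in [y2], so Veblen's axiom gives [t] on both [x w]
    and [p2 y1]. By [cone_join] this [t] is in the cone, and [w] lies on the line [x t].
    Coincidences among these points are treated first. *)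
Lemma flat_cone F x : flat F -> ~ F x -> flat (cone F x).
Proof.
move=> fF Fx y1 y2 y12 c1 c2 w yw.
have nex p : F p -> p != x by move=> Fp; apply: contra_notN Fx => /eqP <-.
have on_line p : F p -> line_through p x y1 -> line_through p x y2 -> cone F x w.
  move=> Fp l1 l2; right; exists p => //.
  by rewrite (line_through_eq (nex p Fp) y12).
have [->|wx] := eqVneq w x; first by left.
have [wF|wF] := pselect (F w); first exact: coneF.
have [wy1|wy1] := eqVneq w y1; first by rewrite wy1.
case: c2 => [y2x|[p2 Fp2 l2]].
  case: c1 => [y1x|[p1 Fp1 l1]]; first by rewrite y1x y2x eqxx in y12.
  by apply: (on_line p1) => //; rewrite y2x; apply: line_throughr; exact: nex.
case: (eqVneq y1 x) => [y1x|y1x].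
  by apply: (on_line p2) => //; rewrite y1x; apply: line_throughr; exact: nex.
have p2x := nex _ Fp2.
have [y1p|y1p] := eqVneq y1 p2.
  by apply: (on_line p2) => //; rewrite y1p; exact: line_throughl.
have wp2 : w != p2 by apply: contra_notN wF => /eqP ->.
have [t [xwt pt]] : line_through x w `&` line_through p2 y1 !=set0.
  apply: (@veblen P x p2 w y1 (line_through x p2) (line_through w y1)).
  - by rewrite /= !inE !negb_or wy1 (eq_sym x p2) p2x (eq_sym x w) wx
        (eq_sym x y1) y1x (eq_sym p2 w) wp2 (eq_sym p2 y1) y1p.
  - by apply: line_throughP; rewrite eq_sym.
  - exact: line_throughP.
  - by apply: line_throughP; rewrite eq_sym.
  - by apply: line_throughP; rewrite eq_sym.
  exists y2; split; first by rewrite line_throughC.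
  rewrite -(line_through_eq y12 wy1) //; [exact: line_throughr|exact: line_throughl].
rewrite line_throughC in pt.
have [tx|tx] := eqVneq t x.
  rewrite {}tx in pt; apply: (on_line p2) => //.
  rewrite -(line_through_eq y1p p2x) //; [exact: line_throughl|exact: line_throughr].
case: (cone_join fF Fx c1 Fp2 y1p pt) => [tx'|[p Fp pxt]].
  by rewrite tx' eqxx in tx.
right; exists p => //; rewrite (line_through_eq (nex _ Fp) tx) //.
  rewrite line_throughC in xwt.
  rewrite -(line_through_eq wx tx) //; [exact: line_throughl|exact: line_throughr].
exact/line_throughr/nex.
Qed.

(** The cone over [span A] with apex [x] is a flat containing [x] and [A], so [y] is on a line
    joining [x] to some [p] in [span A]. As [y] differs from [p], that line is also [p y], and it
    passes through [x]. *)
Lemma span_exchange A x y : span (x |` A) y -> ~ span A y -> span (y |` A) x.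
Proof.
move=> xAy Ay.
have [Ax|Ax] := pselect (span A x).
  by case: Ay; move: xAy; apply: span_sub => w [->|/sub_span].
have fA := @flat_span A.
have : cone (span A) x y.
  move: xAy; apply: span_min; first exact: flat_cone.
  by move=> w [->|/sub_span Aw]; [left|exact: coneF].
case=> [<-|[p Ap pxy]]; first by apply: sub_span; left.
have px : p != x by apply: contra_notN Ax => /eqP <-.
have py : p != y by apply: contra_notN Ay => /eqP <-.
apply: (@flat_span (y |` A) p y) => //.
- by move: Ap; apply: spanS => w; right.
- by apply: sub_span; left.
rewrite -(line_through_eq px py) //; [exact: line_throughr|exact: line_throughl].
Qed.

Lemma proj_indepS A B : A `<=` B -> proj_indep B -> proj_indep A.
Proof.
move=> AB iB x Ax sx; apply: (iB x (AB _ Ax)); move: sx; apply: spanS.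
by move=> y [/AB ? ?]; split.
Qed.

Lemma proj_indepU1 A x : proj_indep A -> ~ span A x -> proj_indep (x |` A).
Proof.
move=> iA Ax y [->|Ay] ys.
  by apply: Ax; move: ys; apply: spanS => w [[->|//] wx]; case: (wx erefl).
have [yx|yx] := pselect (y = x).
  by apply: Ax; rewrite -yx; exact: sub_span.
have sx : span (y |` (A `\ y)) x.
  apply: span_exchange; last exact: iA.
  by move: ys; apply: spanS => w [[->|Aw] wy]; [left|right].
by apply: Ax; move: sx; apply: spanS => w [->|[]].
Qed.

Lemma set_fsetU1E x (A : {fset P}) : [set` (x |` A)%fset] = x |` [set` A].
Proof.
apply/seteqP; split=> y /=; rewrite !inE.
  by case/orP => [/eqP|]; [left|right].
by case=> [->|/= ->]; rewrite ?eqxx ?orbT.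
Qed.

(* Steinitz: trade the elements of [A] outside [B] for elements of [B]. *)
Lemma proj_indep_card (A B : {fset P}) :
  proj_indep [set` A] -> [set` A] `<=` span [set` B] -> #|` A| <= #|` B|.
Proof.
have [n] := ubnP #|` (A `\` B)%fset|; elim: n A => // n IH A.
rewrite ltnS => An iA AB.
have [sAB|/fsubsetPn[a aA aB]] := boolP (A `<=` B)%fset; first exact: fsubset_leq_card.
(* If [A] without [a] spanned all of [B], it would span [a] too, against independence. *)
have [b bB bA] : exists2 b, b \in B & ~ span [set` (A `\ a)%fset] b.
  apply: contrapT => nb; apply: (iA a aA).
  have : span [set` (A `\ a)%fset] a.
    have := AB a aA; apply: span_sub => b bB.
    by apply: contrapT => nbA; apply: nb; exists b.
  by apply: spanS => w /=; rewrite !inE => /andP[/eqP].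
have bnA : b \notin (A `\ a)%fset by apply: contra_notN bA => /(@sub_span [set` _]).
have cA : #|` (b |` (A `\ a))%fset| = #|` A|.
  by rewrite cardfsU1 bnA (cardfsD1 a A) aA.
rewrite -cA; apply: IH.
(* The measure drops: [a] leaves the part of [A] outside [B], and the newcomer [b] lies in [B]. *)
- apply: leq_trans An; rewrite (cardfsD1 a (A `\` B)%fset) !inE aA aB /= add1n ltnS.
  apply: fsubset_leq_card; apply/fsubsetP => w; rewrite !inE.
  case/andP => wB /orP[/eqP wb|/andP[-> ->]]; last by rewrite wB.
  by rewrite wb bB in wB.
- rewrite set_fsetU1E; apply: proj_indepU1 => //.
  by apply: proj_indepS iA => w /=; rewrite !inE => /andP[].
- rewrite set_fsetU1E => w [->|/=]; first exact: sub_span.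
  by rewrite !inE => /andP[_ /AB].
Qed.

Lemma proj_indep0 : proj_indep [set` (fset0 : {fset P})].
Proof. by move=> x /=; rewrite inE. Qed.

Lemma proj_basis_ex (S : {fset P}) : exists B : {fset P},
  [/\ (B `<=` S)%fset, proj_indep [set` B] & [set` S] `<=` span [set` B]].
Proof.
elim/finSet_rect: S => S IH.
have [->|[x xS]] := fset_0Vmem S.
  by exists fset0; split; [exact: fsubset_refl|exact: proj_indep0|exact: sub_span].
have [B [BS iB SB]] := IH _ (fproperD1 xS).
have ES : S = (x |` (S `\ x))%fset by rewrite fsetD1K.
have BS' : (B `<=` S)%fset by exact: fsubset_trans BS (fsubD1set _ _).
have [Bx|Bx] := pselect (span [set` B] x).
  by exists B; split => //; rewrite ES set_fsetU1E => w [->|/SB].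
exists (x |` B)%fset; split.
- by rewrite fsubUset fsub1set xS.
- by rewrite set_fsetU1E; exact: proj_indepU1.
rewrite ES !set_fsetU1E => w [->|/SB]; first by apply: sub_span; left.
by apply: spanS => y; right.
Qed.

Lemma proj_rank_le (S B : {fset P}) : [set` S] `<=` span [set` B] -> proj_rank S <= #|` B|.
Proof.
move=> SB; apply/bigmax_leqP_seq => A.
rewrite fpowersetE => AS /asboolP iA; apply: proj_indep_card => // x /(fsubsetP AS).
exact: SB.
Qed.

Lemma proj_rank_basis (S B : {fset P}) : (B `<=` S)%fset -> proj_indep [set` B] ->
  [set` S] `<=` span [set` B] -> proj_rank S = #|` B|.
Proof.
move=> BS iB SB; apply/eqP; rewrite eqn_leq proj_rank_le //=.
by apply: (@leq_bigmax_seq _ _ _ (fun A : {fset P} => #|` A|));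
  rewrite ?fpowersetE //; apply/asboolP.
Qed.

Lemma proj_rank_span1 (S : {fset P}) x : span [set` S] x ->
  proj_rank (x |` S)%fset = proj_rank S.
Proof.
move=> Sx; have [B [BS iB SB]] := proj_basis_ex S.
rewrite (proj_rank_basis BS iB SB); apply: proj_rank_basis => //.
  exact: fsubset_trans BS (fsubsetU1 _ _).
by rewrite set_fsetU1E => w [->|/SB //]; exact: span_sub Sx.
Qed.

(** A basis of [B] inside [B] spans [A], hence has at least as many elements as [A], and so as [B];
    it is therefore all of [B]. *)
Lemma proj_indep_span (A B : {fset P}) : proj_indep [set` A] ->
  [set` A] `<=` span [set` B] -> #|` B| <= #|` A| -> proj_indep [set` B].
Proof.
move=> iA AB cBA; have [C [CB iC BC]] := proj_basis_ex B.
suff <- : C = B by [].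
apply/eqP; rewrite eqEfcard CB /=; apply: leq_trans cBA _.
by apply: proj_indep_card => // x /AB; apply: span_sub.
Qed.

(** With a basis [B] of [S] fixed, adding [x] raises the rank by one exactly when [x] is outside the
    span of [B]. Whitney's axioms for the lift matroid are later pulled back from these. *)
Lemma proj_matroid_is_matroid (X : set P) : is_matroid (proj_matroid X).
Proof.
split.
  by rewrite /= (proj_rank_basis (fsubset_refl _) proj_indep0) ?cardfs0 //; exact: sub_span.
move=> S _; have [B [BS iB SB]] := proj_basis_ex S.
have rS := proj_rank_basis BS iB SB; rewrite /= in rS *; split.
  move=> x _; have [Bx|Bx] := pselect (span [set` B] x).
    rewrite rS (@proj_rank_basis _ B) ?leqnn ?leqnSn //.
      exact: fsubset_trans BS (fsubsetU1 _ _).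
    by rewrite set_fsetU1E => w [->|/SB].
  have xB : x \notin B by apply: contra_notN Bx => /(@sub_span [set` _]).
  rewrite rS (@proj_rank_basis _ (x |` B)%fset) ?cardfsU1 ?xB ?leqnn ?leqnSn //.
  - exact: fsetUS.
  - by rewrite set_fsetU1E; exact: proj_indepU1.
  rewrite !set_fsetU1E => w [->|/SB]; first by apply: sub_span; left.
  by apply: spanS => y; right.
have inB x : proj_rank (x |` S)%fset = proj_rank S -> span [set` B] x.
  move=> rx; apply: contrapT => Bx.
  have xB : x \notin B by apply: contra_notN Bx => /(@sub_span [set` _]).
  move: rx; rewrite rS (@proj_rank_basis _ (x |` B)%fset) ?cardfsU1 ?xB //.
  - by rewrite add1n => /esym/n_Sn.
  - exact: fsetUS.
  - by rewrite set_fsetU1E; exact: proj_indepU1.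
  rewrite !set_fsetU1E => w [->|/SB]; first by apply: sub_span; left.
  by apply: spanS => y; right.
move=> x y _ _ /inB Bx /inB By; rewrite rS; apply: proj_rank_basis => //.
  exact: fsubset_trans (fsubset_trans BS (fsubsetU1 y _)) (fsubsetU1 _ _).
by rewrite !set_fsetU1E => w [->|[->|/SB]].
Qed.

End Span.

(** * Walks, connectivity, circles and spanning forests in a graph *)

Section Connectivity.
Variable G : graph.
Implicit Types (u v w x y : node G) (s t : seq (edge G * node G)) (S F C : {fset edge G}).

Lemma ends_ex (e : edge G) : exists u v, ends e = [fset u; v]%fset.
Proof.
have := ends_card e; set A := ends e; case/andP=> A0 A2.
have [u uA] : exists u, u \in A by apply/fset0Pn; rewrite -cardfs_gt0.
have [A1|[v vA]] := fset_0Vmem (A `\ u)%fset.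
  by exists u, u; rewrite -(fsetD1K uA) A1 fsetU0 fsetUid.
exists u, v; apply/esym/eqP; rewrite eqEfcard fsubUset !fsub1set uA.
have [vu vA'] : v != u /\ v \in A by move: vA; rewrite !inE => /andP[].
by rewrite vA' cardfs2 (eq_sym u) vu.
Qed.

Lemma is_walk_cat u s t : is_walk u (s ++ t) = is_walk u s && is_walk (walk_end u s) t.
Proof. by elim: s u => [|[e v] s IH] u //=; rewrite IH andbA. Qed.

Lemma walk_end_cat u s t : walk_end u (s ++ t) = walk_end (walk_end u s) t.
Proof. by rewrite /walk_end /unzip2 map_cat last_cat. Qed.

Lemma walk_rev u s : is_walk u s -> exists t,
  [/\ is_walk (walk_end u s) t, walk_end (walk_end u s) t = u, unzip1 t = rev (unzip1 s)
    & walk_end u s :: unzip2 t = rev (u :: unzip2 s)].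
Proof.
elim: s u => [|[e v] s IH] u /=; first by exists [::].
case/andP=> /eqP ev /IH[t [wt et e1 e2]]; exists (rcons t (e, u)).
rewrite -/(walk_end v s) in wt et e2 *; split.
- by rewrite -cats1 is_walk_cat wt et /= ev fsetUC eqxx.
- by rewrite -cats1 walk_end_cat.
- by rewrite /unzip1 map_rcons -/(unzip1 t) e1 rev_cons.
- by rewrite /unzip2 map_rcons -/(unzip2 t) -rcons_cons e2 -rev_cons.
Qed.

Lemma unzip2_split s w : w \in unzip2 s -> exists s1 e s2, s = s1 ++ (e, w) :: s2.
Proof.
move=> /mapP[[e v] es ->] /=; have [s1 s2] := splitPr es.
by exists s1, e, s2.
Qed.

Lemma walk_node_ends u s e : is_walk u s -> e \in unzip1 s ->
  {subset ends e <= u :: unzip2 s}.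
Proof.
elim: s u => [|[e' v] s IH] u //= /andP[/eqP ev ws]; rewrite inE => /orP[/eqP ->|es] x.
  by rewrite ev !inE => /orP[->|->]; rewrite ?orbT.
by move=> /(IH v ws es) xs; rewrite inE xs orbT.
Qed.

Lemma path_uniq_edges u v s : is_path u v s -> uniq (unzip1 s).
Proof.
elim: s u => [|[e w] s IH] u //= [/= /andP[/eqP ew ws] es /andP[us wus]].
rewrite (IH w) ?andbT; last by split.
apply: contraNN us => /(walk_node_ends ws); apply.
by rewrite ew !inE eqxx.
Qed.

Definition conn S u v := exists s,
  [/\ is_walk u s, walk_end u s = v & {subset unzip1 s <= S}].

Lemma conn_refl S u : conn S u u.
Proof. by exists [::]. Qed.

Lemma conn_trans S u v w : conn S u v -> conn S v w -> conn S u w.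
Proof.
move=> [s [ws es sS]] [t [wt et tS]]; exists (s ++ t); split.
- by rewrite is_walk_cat ws es.
- by rewrite walk_end_cat es.
- by move=> e; rewrite /unzip1 map_cat mem_cat => /orP[/sS|/tS].
Qed.

Lemma conn_sym S u v : conn S u v -> conn S v u.
Proof.
move=> [s [ws <- sS]]; have [t [wt et e1 _]] := walk_rev ws.
by exists t; split => // e; rewrite e1 mem_rev => /sS.
Qed.

Lemma connS S F u v : (S `<=` F)%fset -> conn S u v -> conn F u v.
Proof.
by move=> /fsubsetP SF [s [ws es sS]]; exists s; split => // e /sS/SF.
Qed.

Lemma conn_edge S e u v : e \in S -> u \in ends e -> v \in ends e -> conn S u v.
Proof.
move=> eS; have [a [b E]] := ends_ex e; rewrite E !inE.
have ab : conn S a b.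
  exists [:: (e, b)]; split; rewrite //= ?E ?eqxx //.
  by move=> e'; rewrite inE => /eqP ->.
by move=> /orP[]/eqP -> /orP[]/eqP -> //; [exact: conn_refl|exact: conn_sym|exact: conn_refl].
Qed.

(** Labels constant on each edge are constant on connected nodes. The target is an arbitrary type so
    that propositions can serve as labels, as in [feet_conn]. *)
Lemma conn_inv (T : Type) (f : node G -> T) S u v :
  (forall e x y, e \in S -> x \in ends e -> y \in ends e -> f x = f y) ->
  conn S u v -> f u = f v.
Proof.
move=> fS [s [ws <- sS]]; elim: s u ws sS => [|[e w] s IH] u //= /andP[/eqP ew ws] sS.
rewrite (fS e u w) ?ew ?inE ?eqxx ?orbT //; last by apply: sS; rewrite inE eqxx.
by rewrite (IH w) // => e' e's; apply: sS; rewrite inE e's orbT.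
Qed.

Lemma conn_path S u v : conn S u v ->
  exists2 s, is_path u v s & {subset unzip1 s <= S}.
Proof.
move=> [s [ws <- sS]]; elim: s u ws sS => [|[e w] s IH] u /=; first by exists [::].
case/andP=> ew ws sS.
have [|t [wt et ut] tS] := IH w ws; first by move=> e' e's; apply: sS; rewrite inE e's orbT.
rewrite -[walk_end u _]/(walk_end w s).
(* Loop erasure: if the path from [w] returns to [u], only its portion after that visit is kept. *)
have [ut'|ut'] := boolP (u \in w :: unzip2 t); last first.
  exists ((e, w) :: t).
    by split; [rewrite /= ew wt|exact: et|rewrite cons_uniq ut'].
  by move=> e' /=; rewrite inE => /orP[/eqP ->|/tS //]; apply: sS; rewrite inE eqxx.
move: ut'; rewrite inE => /orP[/eqP ->|ut']; first by exists t.
have [t1 [e' [t2 E]]] := unzip2_split ut'; rewrite {}E in wt et ut tS.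
exists t2; first split.
- by move: wt; rewrite is_walk_cat => /andP[_ /andP[]].
- by move: et; rewrite walk_end_cat.
- by move: ut; rewrite /= /unzip2 map_cat cat_uniq => /andP[_ /and3P[]].
by move=> a at2; apply: tS; rewrite /unzip1 map_cat mem_cat inE at2 !orbT.
Qed.

(** What remains of the circle after deleting [e] is a path: follow [s2] from the far end of [e] to
    the base node [w], then [s1] to the near end. *)
Lemma circle_conn C e x y : is_circle C -> e \in C -> x \in ends e -> y \in ends e ->
  conn (C `\ e)%fset x y.
Proof.
move=> [w [s [_ ws es /andP[_ us] ->]]].
rewrite /walk_edges inE => /mapP[[e' v] + /= E]; rewrite -{}E => evs.
case/splitPr: evs ws es us => s1 s2.
set K := (walk_edges _ `\ e)%fset; rewrite is_walk_cat walk_end_cat /unzip1 map_cat cat_uniq.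
set u := walk_end w s1; move=> /andP[ws1 /= /andP[/eqP ee ws2]].
rewrite -[walk_end u _]/(walk_end v s2) => es2.
case/and3P=> _; rewrite negb_or => /andP[e1 _] /andP[e2 _].
have uv : conn K u v.
  apply: conn_sym; apply: (@conn_trans _ _ w).
    exists s2; split => // a as2; rewrite /K !inE /unzip1 map_cat mem_cat inE as2 !orbT andbT.
    by apply: contraNneq e2 => <-.
  exists s1; split => // a as1; rewrite /K !inE /unzip1 map_cat mem_cat as1 andbT.
  by apply: contraNneq e1 => <-.
rewrite ee !inE => /orP[]/eqP -> /orP[]/eqP -> //.
- exact: conn_refl.
- exact: conn_sym.
- exact: conn_refl.
Qed.

(** A path in [F] from [u] to [v] is closed up by [e]. Applied to a forest [F], this yields the
    fundamental circle of [e]. *)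
Lemma conn_circle F e u v : ends e = [fset u; v]%fset -> u != v -> e \notin F -> conn F u v ->
  exists C, [/\ is_circle C, e \in C & (C `<=` e |` F)%fset].
Proof.
move=> ee uv eF /conn_path[s ps sF]; have us := path_uniq_edges ps.
case: ps => ws es nus; exists (walk_edges (rcons s (e, u))); split.
- exists u, (rcons s (e, u)); split => //.
  + by case: (s).
  + by rewrite -cats1 is_walk_cat ws es /= ee fsetUC eqxx.
  + by rewrite -cats1 walk_end_cat.
  + rewrite /unzip1 /unzip2 !map_rcons !rcons_uniq us.
    by rewrite (contraNN (@sF e) eF) !andbT.
- by rewrite inE /unzip1 map_rcons mem_rcons inE eqxx.
- apply/fsubsetP => a; rewrite !inE /unzip1 map_rcons mem_rcons inE => /orP[->//|/sF ->].
  by rewrite orbT.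
Qed.

Lemma nodes_ofP S x : reflect (exists2 e, e \in S & x \in ends e) (x \in nodes_of S).
Proof.
apply: (iffP (bigfcupP _ _ _ _)) => [[e /andP[eS _] xe]|[e eS xe]]; exists e => //.
by rewrite eS.
Qed.

(* [f] labels the components; [W] may contain nodes isolated in [S]. *)
Definition spanning_forest S F (f : node G -> node G) :=
  [/\ (F `<=` S)%fset, graphic_indep [set` F], forall x y, f x = f y <-> conn F x y,
      forall x y, conn S x y -> conn F x y
    & forall W : {fset node G}, (nodes_of S `<=` W)%fset ->
        #|` W| = #|` [fset f x | x in W]%fset| + #|` F|].

(* The labelling is updated as in union-find when an edge is added. *)
Lemma spanning_forest_ex S : exists F f, spanning_forest S F f.
Proof.
elim/finSet_rect: S => S IH.
have [->|[e eS]] := fset_0Vmem S.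
  exists fset0, id; split=> //.
  - move=> C [u [[|[e v] s] [// _ _ _ _ ->]]] /(_ e) /=; rewrite !inE => /(_ _).
    by rewrite eqxx => /(_ isT).
  - move=> x y; split=> [->|]; first exact: conn_refl.
    by apply: conn_inv => e ? ?; rewrite inE.
  - by move=> W _; rewrite cardfs0 addn0 imfset_id.
have [F [f [FS aF fF SF cF]]] := IH _ (fproperD1 eS).
have [u [v ee]] := ends_ex e.
have fe a x y : a \in S -> a != e -> x \in ends a -> y \in ends a -> f x = f y.
  by move=> aS ae xa ya; apply/fF/SF/(conn_edge _ xa ya); rewrite !inE ae.
have FS' : (F `<=` S)%fset by exact: fsubset_trans FS (fsubD1set _ _).
have sW W : (nodes_of S `<=` W)%fset -> (nodes_of (S `\ e) `<=` W)%fset.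
  move=> /fsubsetP SW; apply/fsubsetP => x /nodes_ofP[a]; rewrite !inE => /andP[_ aS] xa.
  by apply/SW/nodes_ofP; exists a.
(* When the ends of [e] already carry the same label, forest and labels are kept. *)
have [fuv|fuv] := eqVneq (f u) (f v).
  exists F, f; split => //; last by move=> W /sW; exact: cF.
  move=> x y; move=> xy; apply/fF; move: xy; apply: conn_inv => a x' y' aS.
  have [->|ae] := eqVneq a e; last exact: fe.
  by rewrite ee !inE => /orP[]/eqP -> /orP[]/eqP ->.
have eF : e \notin F by apply/negP => /(fsubsetP FS); rewrite !inE eqxx.
(* Otherwise [e] joins the forest and the class of [u] is merged into that of [v]. *)
pose f' x := if f x == f u then f v else f x.
have f'u : f' u = f v by rewrite /f' eqxx.
have f'v : f' v = f v by rewrite /f' eq_sym (negbTE fuv).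
have FF : (F `<=` e |` F)%fset by exact: fsubsetU1.
have uv : conn (e |` F)%fset u v.
  by apply: (@conn_edge _ e); rewrite ?ee !inE ?eqxx ?orbT.
have f'inv a x y : a \in S -> x \in ends a -> y \in ends a -> f' x = f' y.
  have [->|ae] := eqVneq a e; last by move=> aS xa ya; rewrite /f' (fe a x y).
  by rewrite ee !inE => _ /orP[]/eqP -> /orP[]/eqP ->; rewrite ?f'u ?f'v.
have f'F x y : f' x = f' y -> conn (e |` F)%fset x y.
  rewrite /f'; case: (f x =P f u) => [/fF xu|_]; case: (f y =P f u) => [/fF yu|_].
  - by move=> _; apply: connS FF _; apply: conn_trans xu (conn_sym yu).
  - by move=> /fF /(connS FF); apply: conn_trans; apply: conn_trans uv; exact: connS xu.
  - move=> /fF /(connS FF) xv; apply: conn_trans xv _; apply: conn_trans (conn_sym uv) _.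
    by apply: connS FF _; exact: conn_sym.
  - by move=> /fF /(connS FF).
exists (e |` F)%fset, f'; split.
- by rewrite fsubUset fsub1set eS.
(* A circle through [e] would, once [e] is deleted, connect [u] and [v] within [F], and their labels
   would have agreed. *)
- move=> C cC CF; have [eC|eC] := boolP (e \in C).
    move/eqP: fuv; apply; apply/fF.
    have : conn (C `\ e)%fset u v by apply: circle_conn; rewrite // ee !inE eqxx ?orbT.
    apply: connS; apply/fsubsetP => a; rewrite !inE => /andP[ae /CF] /=.
    by rewrite !inE (negbTE ae).
  apply: (aF C cC) => a /= aC; have := CF a aC; rewrite /= !inE => /orP[/eqP E|//].
  by rewrite -E aC in eC.
- move=> x y; split; first exact: f'F.
  apply: conn_inv => a x' y'; rewrite !inE => /orP[/eqP ->|/(fsubsetP FS')]; exact: f'inv.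
- by move=> x y xy; apply: f'F; move: xy; exact: conn_inv.
- move=> W SW; rewrite (cF W (sW _ SW)) cardfsU1 eF addnA; congr addn.
  have inW x : x \in ends e -> x \in W by move=> xe; apply/(fsubsetP SW)/nodes_ofP; exists e.
  have [uW vW] : u \in W /\ v \in W by rewrite !inW ?ee ?inE ?eqxx ?orbT.
  (* The merge loses exactly the label [f u], which offsets the one edge gained. *)
  rewrite (cardfsD1 (f u)) in_imfset //= addnC; congr (#|` _| + _).
  apply/fsetP => y; rewrite !inE; apply/andP/imfsetP => /=.
    by case=> yu /imfsetP[x /= xW E]; exists x => //; rewrite /f' -E (negbTE yu).
  case=> x xW ->; rewrite /f'; case: ifP => fx.
    by rewrite eq_sym fuv in_imfset.
  by rewrite fx in_imfset.
Qed.

End Connectivity.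

(** * Graphic rank as the size of a spanning forest, and theta graphs *)

Section ForestRank.
Variable G : graph.
Implicit Types (u v w x y : node G) (s t : seq (edge G * node G)) (S F C T : {fset edge G}).

Lemma conn_connect S (x y : nodes_of S) : conn S (val x) (val y) -> connect (@adj G S) x y.
Proof.
(* Reachability from [x], extended by [false] outside [nodes_of S], is a label on all nodes, so that
   [conn_inv] applies. *)
move=> xy; pose f v := if insub v is Some v' then connect (@adj G S) x v' else false.
have fE v (vN : v \in nodes_of S) : f v = connect (@adj G S) x [` vN]%fset.
  by rewrite /f (_ : insub v = Some [` vN]%fset) //; exact: (valK [` vN]%fset).
suff : f (val x) = f (val y) by rewrite /f !valK connect0 => <-.
move: xy; apply: conn_inv => e a b eS ae be.
have aN : a \in nodes_of S by apply/nodes_ofP; exists e.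
have bN : b \in nodes_of S by apply/nodes_ofP; exists e.
rewrite !fE.
suff ab : connect (@adj G S) [` aN]%fset [` bN]%fset /\ connect (@adj G S) [` bN]%fset [` aN]%fset.
  by apply/idP/idP => h; apply: connect_trans h _; case: ab.
have [u [v ee]] := ends_ex e; move: ae be; rewrite ee !inE.
have adjab a' b' (a'N : a' \in nodes_of S) (b'N : b' \in nodes_of S) :
    ends e = [fset a'; b']%fset -> connect (@adj G S) [` a'N]%fset [` b'N]%fset.
  by move=> E; apply: connect1; apply/hasP; exists e => //=; rewrite E.
case/orP=> /eqP au; case/orP=> /eqP bu.
- by move: aN bN; rewrite au bu => aN bN; rewrite (bool_irrelevance aN bN); split; exact: connect0.
- by split; apply: adjab; rewrite ee au bu // fsetUC.
- by split; apply: adjab; rewrite ee au bu // fsetUC.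
- by move: aN bN; rewrite au bu => aN bN; rewrite (bool_irrelevance aN bN); split; exact: connect0.
Qed.

Lemma connect_conn S (x y : nodes_of S) : connect (@adj G S) x y -> conn S (val x) (val y).
Proof.
case/connectP => p + ->; elim: p x => [|a p IH] x /=; first by move=> _; exact: conn_refl.
case/andP=> /hasP[e eS /eqP ee] /IH; apply: conn_trans.
by apply: (@conn_edge _ _ e); rewrite // ee !inE eqxx ?orbT.
Qed.

(** [ncomp] counts the roots of the components; [f] is injective on the roots, and each label on
    [nodes_of S] is the label of a root. *)
Lemma ncomp_labels (I : choiceType) S (f : node G -> I) :
  (forall x y, f x = f y <-> conn S x y) -> ncomp S = #|` [fset f x | x in nodes_of S]%fset|.
Proof.
move=> fS; pose r := enum (roots (@adj G S)).
have adj_sym : connect_sym (@adj G S).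
  by move=> x y; apply/idP/idP => /connect_conn/conn_sym/conn_connect.
have -> : ncomp S = size r.
  by rewrite /ncomp /n_comp_mem -cardE; apply: eq_card => x; rewrite !inE andbT.
pose g (x : nodes_of S) := f (val x).
have ur : uniq (map g r).
  rewrite map_inj_in_uniq ?enum_uniq // => x y; rewrite !mem_enum => /eqP rx /eqP ry.
  by move/fS/conn_connect; rewrite -(root_connect adj_sym) rx ry => /eqP.
rewrite -(size_map g) -(undup_id ur) -card_fseq; congr (#|` _|).
apply/fsetP => a; rewrite !inE; apply/mapP/imfsetP => /=.
  by case=> x _ ->; exists (val x) => //; exact: valP.
case=> x xN ->; exists (root (@adj G S) [` xN]%fset).
  by rewrite mem_enum; exact: roots_root.
by apply/fS; apply: (@connect_conn S [` xN]%fset); exact: connect_root.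
Qed.

(** This is the counting clause of [spanning_forest] at [W = nodes_of S], where labels number the
    components; in particular the subtraction is not truncated. *)
Lemma spanning_forest_rank S F f : spanning_forest S F f ->
  #|` nodes_of S| - ncomp S = #|` F|.
Proof.
case=> FS _ fF SF cF; rewrite (@ncomp_labels _ S f) => [|x y].
  by rewrite (cF _ (fsubset_refl _)) addKn.
by split=> [/fF/(connS FS)//|/SF/fF].
Qed.

Lemma path_neq_nil u v s : u != v -> is_path u v s -> s != [::].
Proof. by case: s => // uv [_ /= E _]; rewrite -E eqxx in uv. Qed.

(** Run along [s] and back along the reversal [r] of [t]. The node list of [s] omits [u] and that of
    [r] omits [v], so no node is repeated. *)
Lemma theta_circle u v s t : u != v -> is_path u v s -> is_path u v t ->
  internally_disjoint v s t -> is_circle (walk_edges s `|` walk_edges t)%fset.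
Proof.
move=> uv ps pt [de dn].
have us := path_uniq_edges ps; have ut := path_uniq_edges pt.
have s0 := path_neq_nil uv ps.
case: ps pt => ws es nus [wt et nut].
have [r [wr er r1 r2]] := walk_rev wt; rewrite et in wr er r2.
exists u, (s ++ r); split.
- by case: (s) s0.
- by rewrite is_walk_cat ws es.
- by rewrite walk_end_cat es er.
- rewrite /unzip1 /unzip2 !map_cat -/(unzip1 s) -/(unzip1 r) -/(unzip2 s) -/(unzip2 r) !cat_uniq.
  have nvr : uniq (v :: unzip2 r) by rewrite r2 rev_uniq.
  move: (nus) (nvr) => /= /andP[us' ->] /andP[vr ->]; rewrite us r1 rev_uniq ut !andbT /=.
  apply/andP; split; apply/hasPn => a /=.
    move=> ar; apply/negP => as'.
    have : a \in v :: unzip2 r by rewrite inE ar orbT.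
    rewrite r2 mem_rev inE => /orP[/eqP E|at'].
      by rewrite -E as' in us'.
    by rewrite (dn a as' at') (negbTE vr) in ar.
  by rewrite mem_rev; apply: contraTN; exact: de.
- apply/fsetP => a; rewrite !inE /unzip1 map_cat mem_cat -/(unzip1 r) r1.
  by rewrite mem_rev.
Qed.

Lemma path_nodes_conn u v s w : is_path u v s -> w \in u :: unzip2 s -> conn (walk_edges s) u w.
Proof.
move=> [ws _ _]; rewrite inE => /orP[/eqP->|wS]; first exact: conn_refl.
have [s1 [e [s2 E]]] := unzip2_split wS; rewrite E in ws *.
exists (s1 ++ [:: (e, w)]); split.
- by move: ws; rewrite !is_walk_cat /= => /andP[-> /andP[->]].
- by rewrite walk_end_cat.
- by move=> a; rewrite !inE /unzip1 !map_cat !mem_cat !inE => /orP[->//|->]; rewrite ?orbT.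
Qed.

(* A theta graph is connected and has one edge more than it has nodes. *)
Lemma theta_forest_card T F f : is_theta T -> spanning_forest T F f -> #|` T| <= #|` F|.+2.
Proof.
move=> [u [v [s1 [s2 [s3 [uv [p1 p2 p3] [d12 d13 d23] ET]]]]]] [FT _ fF TF cF].
(* [b s] lists the internal nodes of a path [s]; thus [l] lists each node of the theta graph
   once. *)
pose b s := rem v (unzip2 s).
pose l := u :: unzip2 s1 ++ b s2 ++ b s3.
have vs s : is_path u v s -> v \in unzip2 s.
  move=> ps; have := path_neq_nil uv ps; case: ps => _ + _.
  case: s => // -[e w] s; rewrite /walk_end /= => <- _; exact: mem_last.
have memb s x : is_path u v s -> (x \in b s) = (x != v) && (x \in unzip2 s).
  by case=> _ _ /= /andP[_ us]; rewrite /b mem_rem_uniq // !inE.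
have usb s : is_path u v s -> u \notin b s.
  by move=> ps; rewrite memb //; case: ps => _ _ /= /andP[/negbTE ->]; rewrite andbF.
have ub s : is_path u v s -> uniq (b s).
  by case=> _ _ /= /andP[_ us]; exact: rem_uniq.
have ul : uniq l.
  rewrite /l /= !mem_cat !cat_uniq !negb_or !ub // !usb //.
  case: (p1) => _ _ /= /andP[-> ->] /=; rewrite !andbT; apply/andP; split.
    rewrite has_cat negb_or; apply/andP; split; apply/hasPn => x; rewrite memb //=.
      by case/andP=> xv x2; apply: contraNN xv => x1; apply/eqP; apply: d12.2.
    by case/andP=> xv x2; apply: contraNN xv => x1; apply/eqP; apply: d13.2.
  apply/hasPn => x; rewrite !memb //= => /andP[xv x3]; rewrite xv /=.
  by apply: contraNN xv => x2; apply/eqP; apply: d23.2.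
have sl : size l = (size s1 + (size s2).-1 + (size s3).-1).+1.
  by rewrite /l /= !size_cat !size_rem ?vs // !size_map addnA.
pose W := [fset x in l]%fset.
have lP x : x \in u :: unzip2 s1 \/ x \in u :: unzip2 s2 \/ x \in u :: unzip2 s3 -> x \in l.
  rewrite /l !inE !mem_cat !memb // => h.
  have [->|xu] := eqVneq x u => //=; move: h; rewrite (negbTE xu) /=.
  have [->|xv] := eqVneq x v; first by rewrite vs.
  by case=> [->//|[->|->]]; rewrite ?orbT.
have lconn x : x \in l -> conn T u x.
  have sub1 : (walk_edges s1 `<=` T)%fset by rewrite ET; apply/fsubsetP => a; rewrite !inE => ->.
  have sub2 : (walk_edges s2 `<=` T)%fset.
    by rewrite ET; apply/fsubsetP => a; rewrite !inE => ->; rewrite orbT.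
  have sub3 : (walk_edges s3 `<=` T)%fset.
    by rewrite ET; apply/fsubsetP => a; rewrite !inE => ->; rewrite orbT.
  rewrite inE => /orP[/eqP ->|]; first exact: conn_refl.
  rewrite !mem_cat => /orP[h|/orP[|]].
  - by apply: connS sub1 _; apply: (path_nodes_conn p1); rewrite inE h orbT.
  - rewrite memb // => /andP[_ h].
    by apply: connS sub2 _; apply: (path_nodes_conn p2); rewrite inE h orbT.
  - rewrite memb // => /andP[_ h].
    by apply: connS sub3 _; apply: (path_nodes_conn p3); rewrite inE h orbT.
have NW : (nodes_of T `<=` W)%fset.
  apply/fsubsetP => x /nodes_ofP[e eT xe].
  have h : [|| e \in unzip1 s1, e \in unzip1 s2 | e \in unzip1 s3].
    by move: eT; rewrite ET !inE -orbA.
  suff xl : x \in l by apply/imfsetP; exists x.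
  apply: lP; case/or3P: h => h.
  - by left; case: p1 => w1 _ _; exact: (walk_node_ends w1 h).
  - by right; left; case: p2 => w1 _ _; exact: (walk_node_ends w1 h).
  - by right; right; case: p3 => w1 _ _; exact: (walk_node_ends w1 h).
(* The theta graph is connected, so all its nodes share one label and the forest has one edge fewer
   than [l] has nodes. *)
have fW : [fset f x | x in W]%fset = [fset f u]%fset.
  apply/fsetP => a; rewrite !inE; apply/imfsetP/eqP => /= [[x]|->].
    by case/imfsetP => y /= /lconn/TF/fF uy -> ->.
  by exists u => //; apply/imfsetP; exists u; rewrite //= mem_head.
have := cF W NW; rewrite fW cardfs1 add1n /W card_fseq undup_id // sl => -[<-].
have cT : #|` T| <= size s1 + size s2 + size s3.
  have ce s : #|` walk_edges s| <= size s.
    by rewrite /walk_edges card_fseq (leq_trans (size_undup _)) // size_map.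
  have cU (A B : {fset edge G}) : #|` (A `|` B)%fset| <= #|` A| + #|` B|.
    by rewrite cardfsU leq_subr.
  by rewrite ET; apply: leq_trans (cU _ _) (leq_add (leq_trans (cU _ _) (leq_add _ _)) _).
(* The paths [s2] and [s3] are nonempty, so the predecessors in [sl] are genuine. *)
apply: leq_trans cT _; case: (s2) (path_neq_nil uv p2) => // ? ? _.
by case: (s3) (path_neq_nil uv p3) => //= ? ? _; rewrite !(addnS, addSn).
Qed.

End ForestRank.

(** * Points on the edge lines: independence, balance and rank *)

Section Representation.
Variables (P : projGeom) (H : set P) (hypH : hyperplane H).
Variables (D : graph) (D_simple : is_simple D).
Variables (z : edge D -> P) (zH : forall f : edge D, H (z f)) (z_repr : proj_repr z).
Variables (e0 : P) (e0H : ~ H e0) (X : set P) (hX : X `<=` edge_lines z e0 `\ e0).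

Let G := Omega0_graph hX.
Implicit Types (e : edge G) (A S F C T : {fset edge G}).

Let ft (e : edge G) : edge D := foot hX e.
Let pv (e : edge G) : P := val (e : X).
Let pts (A : {fset edge G}) : set P := [set pv e | e in [set` A]].
Let feet (A : {fset edge G}) : {fset edge D} := [fset ft e | e in A]%fset.

Lemma point_neq_apex e : pv e != e0.
Proof. by have [_ /= ne] := hX (set_mem (valP (e : X))); apply/eqP. Qed.

Lemma repr_neq_apex f : z f != e0.
Proof. by apply: contra_notN e0H => /eqP <-. Qed.

Lemma foot_line e : line_through (z (ft e)) e0 (pv e).
Proof. exact: (svalP (cid (foot_ex hX e))). Qed.

(** Together with [foot_span]: in any span containing the apex, a point and the representing point
    of its edge are interchangeable, since both lie on one line through [e0] and differ from
    [e0]. *)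
Lemma point_span e (B : set P) : span B e0 -> span B (z (ft e)) -> span B (pv e).
Proof.
by move=> B0 Bz; apply: (flat_span (repr_neq_apex (ft e)) Bz B0); exact: foot_line.
Qed.

Lemma foot_span e (B : set P) : span B e0 -> span B (pv e) -> span B (z (ft e)).
Proof.
move=> B0 Be; apply: (flat_span (point_neq_apex e) Be B0).
rewrite -(line_through_eq (repr_neq_apex (ft e)) (point_neq_apex e)).
- exact: line_throughl (repr_neq_apex _).
- exact: foot_line.
- exact: line_throughr (repr_neq_apex _).
Qed.

Lemma ends_neq e u v : ends e = [fset u; v]%fset -> u != v.
Proof.
have := (D_simple.1 (ft e)); rewrite -[ends (ft e)]/(@ends G e) => c2 E.
by move: c2; rewrite E cardfs2; case: eqP.
Qed.

Lemma feetP A f : reflect (exists2 e, e \in A & f = ft e) (f \in feet A).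
Proof. exact: imfsetP. Qed.

(** Two edges over the same foot are parallel and form a circle of length two. *)
Lemma ft_inj F : graphic_indep [set` F] -> {in F &, injective ft}.
Proof.
move=> aF e e' eF e'F ee'; apply: contrapT => /eqP ne.
have [u [v E]] := ends_ex e.
have E' : ends e' = [fset u; v]%fset by rewrite -E -[LHS]/(@ends D (ft e')) -ee'.
have e'e : e \notin [fset e']%fset by rewrite inE.
have uv : conn [fset e']%fset u v.
  by apply: (@conn_edge _ _ e'); rewrite ?E' !inE eqxx ?orbT.
have [C [cC eC CF]] := conn_circle E (ends_neq E) e'e uv.
apply: (aF C cC) => a /(fsubsetP CF); rewrite !inE.
by case/orP=> /eqP ->.
Qed.

Lemma feet_card F : graphic_indep [set` F] -> #|` feet F| = #|` F|.
Proof. by move=> aF; rewrite card_in_imfset //; exact: ft_inj. Qed.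

Lemma lift_walk A u (s : seq (edge D * node D)) : is_walk u s ->
  {subset unzip1 s <= feet A} -> exists t : seq (edge G * node G),
  [/\ @is_walk G u t, unzip2 t = unzip2 s, map ft (unzip1 t) = unzip1 s
    & {subset unzip1 t <= A}].
Proof.
elim: s u => [|[f v] s IH] u /=; first by exists [::].
case/andP=> fuv /IH{}IH sA.
have [|t [wt t2 t1 tA]] := IH; first by move=> a as'; apply: sA; rewrite inE as' orbT.
have /feetP[e eA fe] : f \in feet A by apply: sA; rewrite mem_head.
exists ((e, v) :: t); split.
- by rewrite /= wt andbT -(eqP fuv) fe.
- by rewrite /= -t2.
- by rewrite /= -t1 fe.
- by move=> a; rewrite inE => /orP[/eqP -> //|/tA].
Qed.

(** A circle among the feet lifts edge by edge to a closed walk in [F] with the same nodes; its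
    edges are distinct because their feet are. *)
Lemma feet_acyclic F : graphic_indep [set` F] -> graphic_indep [set` feet F].
Proof.
move=> aF C [u [s [s0 ws es /andP[u2 u1] ->]]] sF.
have [|t [wt t2 t1 tA]] := @lift_walk F u s ws.
  by move=> f fs; apply: sF; rewrite /= inE.
apply: (aF (walk_edges t)) => [|e /=]; last by rewrite inE => /tA.
exists u, t; split => //.
- by case: t t2 {wt t1 tA} => //; case: (s) s0.
- by rewrite /walk_end t2.
- by rewrite t2 u2 /=; apply: (@map_uniq _ _ ft); rewrite t1.
Qed.

Lemma feet_conn A u v : conn A u v -> @conn D (feet A) u v.
Proof.
move=> uv; suff <- : @conn D (feet A) u u = @conn D (feet A) u v by exact: conn_refl.
apply: (@conn_inv G Prop (fun w => @conn D (feet A) u w) A u v _ uv) => e x y eA xe ye.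
have xy : @conn D (feet A) x y.
  by apply: (@conn_edge D _ (ft e)) => //; apply/feetP; exists e.
by rewrite propeqE; split=> h; apply: conn_trans h _ => //; exact: conn_sym.
Qed.

(** The ends of [e] are connected in a spanning forest [F] of [A], hence through the feet of [F]. So
    the foot of [e] is among these feet or closes a circle with them in [D]; either way its
    representing point is in their span. The apex transfers this back to the points. *)
Lemma conn_span A e : (forall x y, x \in ends e -> y \in ends e -> conn A x y) ->
  span (e0 |` pts A) (pv e).
Proof.
move=> eA; have [F [f [FA aF _ AF _]]] := spanning_forest_ex A.
have sp0 : span (e0 |` pts A) e0 by apply: sub_span; left.
have zF g : g \in feet F -> span (e0 |` pts A) (z g).
  case/feetP=> e' e'F ->; apply: foot_span => //.
  by apply: sub_span; right; exists e' => //=; apply: (fsubsetP FA).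
apply: point_span => //.
have [eF|eF] := boolP (ft e \in feet F); first exact: zF.
have [u [v E]] := ends_ex e.
have uv : @conn D (feet F) u v.
  by apply: feet_conn; apply: AF; apply: eA; rewrite E !inE eqxx ?orbT.
have [C [cC eC CF]] := conn_circle (E : ends (ft e) = _) (ends_neq E) eF uv.
suff : span (z @` [set` feet F]) (z (ft e)).
  by apply: span_sub => _ [g gF <-]; exact: zF.
(* Otherwise adding [z (ft e)] would keep independence, and by the representation the circle [C]
   could not exist. *)
apply: contrapT => nz; have iz := (z_repr.2 _).1 (feet_acyclic aF).
have := proj_indepU1 iz nz; rewrite -image_set1 -image_setU => /z_repr.2 /(_ C cC); apply.
by move=> a /(fsubsetP CF); rewrite !inE => /orP[/eqP ->|]; [left|right].
Qed.

(** The other edges of [C] connect the ends of [e], so its point is spanned by theirs with the apex.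
    If the apex were essential here, exchange would put it in the span of [C]. *)
Lemma circle_span C e : is_circle C -> ~ span (pts C) e0 -> e \in C ->
  span (pts (C `\ e)%fset) (pv e).
Proof.
move=> cC C0 eC; apply: contrapT => ne; apply: C0.
have : span (pv e |` pts (C `\ e)%fset) e0.
  apply: span_exchange ne; apply: conn_span => x y xe ye; exact: circle_conn.
apply: spanS => _ [->|[a /= + <-]]; first by exists e.
by rewrite !inE => /andP[_ aC]; exists a.
Qed.

Definition point_fset A : {fset P} := [fset pv e | e in A]%fset.

Lemma point_fsetE A : [set` point_fset A] = pts A.
Proof.
apply/seteqP; split=> x /=.
  by case/imfsetP=> e /= eA ->; exists e.
by case=> e /= eA <-; apply/imfsetP; exists e.
Qed.

Lemma point_fset_card A : #|` point_fset A| = #|` A|.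
Proof. by rewrite card_imfset //; exact: val_inj. Qed.

Lemma apex_notin_point_fset A : e0 \notin point_fset A.
Proof. by apply/imfsetP => -[e _ E]; have := point_neq_apex e; rewrite -E eqxx. Qed.

Lemma ptsS A S : (A `<=` S)%fset -> pts A `<=` pts S.
Proof. by move=> /fsubsetP AS _ [e /AS eS <-]; exists e. Qed.

(** The apex is outside the hyperplane carrying the points [z f], so it is independent of them. The
    points of [F] with the apex span the same representing points and are equally many, so
    [proj_indep_span] applies. *)
Lemma forest_indep F : graphic_indep [set` F] -> proj_indep (e0 |` pts F).
Proof.
move=> aF; rewrite -point_fsetE -set_fsetU1E.
pose zF := [fset z f | f in feet F]%fset.
have zFE : [set` zF] = z @` [set` feet F].
  apply/seteqP; split=> x /=; first by case/imfsetP=> f /= fF ->; exists f.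
  by case=> f /= fF <-; apply/imfsetP; exists f.
have e0z : ~ span [set` zF] e0.
  apply: contra_not e0H; apply: span_min; first by case: hypH.
  by rewrite zFE => _ [f _ <-].
apply: (@proj_indep_span P (e0 |` zF)%fset).
- rewrite set_fsetU1E; apply: proj_indepU1 => //; rewrite zFE.
  exact/z_repr.2/feet_acyclic.
- rewrite !set_fsetU1E point_fsetE zFE => _ [->|[f /= /feetP[e eF ->] <-]].
    by apply: sub_span; left.
  by apply: foot_span; apply: sub_span; [left|right; exists e].
- have e0z' : e0 \notin zF by apply: contra_notN e0z => /(@sub_span _ [set` _]).
  rewrite !cardfsU1 e0z' apex_notin_point_fset point_fset_card card_imfset ?feet_card //.
  exact: z_repr.1.
Qed.

Lemma forest_span S F f : spanning_forest S F f -> pts S `<=` span (e0 |` pts F).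
Proof.
case=> _ _ _ SF _ _ [e /= eS <-]; apply: conn_span => x y xe ye.
by apply: SF; apply: conn_edge ye.
Qed.

Lemma balanced_forest_span S F f : spanning_forest S F f -> @balanced (Omega0 hX) S ->
  pts S `<=` span (pts F).
Proof.
move=> [FS _ _ SF _] bS _ [e /= eS <-].
have [eF|eF] := boolP (e \in F); first by apply: sub_span; exists e.
have [u [v E]] := ends_ex e.
have uv : conn F u v.
  by apply: SF; apply: (conn_edge eS); rewrite E !inE eqxx ?orbT.
have [C [cC eC CF]] := conn_circle E (ends_neq E) eF uv.
have CS : (C `<=` S)%fset.
  by apply: fsubset_trans CF _; rewrite fsubUset fsub1set eS.
have [_ [_ C0]] := bS C CS cC.
have := circle_span cC C0 eC; apply: spanS; apply: ptsS.
by apply/fsubsetP => a; rewrite !inE => /andP[ae /(fsubsetP CF)]; rewrite !inE (negbTE ae).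
Qed.

(** For balanced [S] an apex in the span of [S] would lie in the span of a forest, against
    [forest_indep]. Conversely, a circle inside [S] spans no more than [S] does. *)
Lemma balancedP S : @balanced (Omega0 hX) S <-> ~ span (pts S) e0.
Proof.
split=> [bS|S0 C CS cC]; last first.
  split=> //; split; first exact: flat_span.
  by apply: contra_not S0; apply: spanS; exact: ptsS.
have [F [f sF]] := spanning_forest_ex S.
have [_ aF _ _ _] := sF.
move=> /(span_sub (balanced_forest_span sF bS)) F0.
apply: (forest_indep aF (x := e0)); first by left.
move: F0; apply: spanS => _ [e eF <-]; split; first by right; exists e.
by move/eqP; rewrite (negbTE (point_neq_apex e)).
Qed.

Lemma rank_apex S F f : spanning_forest S F f ->
  proj_rank (e0 |` point_fset S)%fset = #|` F|.+1.
Proof.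
move=> sF; have [FS aF _ _ _] := sF.
rewrite (@proj_rank_basis _ _ (e0 |` point_fset F)%fset).
- by rewrite cardfsU1 apex_notin_point_fset point_fset_card.
- apply: fsetUS; apply/fsubsetP => _ /imfsetP[e /= eF ->]; apply/imfsetP; exists e => //.
  exact: (fsubsetP FS).
- by rewrite set_fsetU1E point_fsetE; exact: forest_indep.
rewrite !set_fsetU1E !point_fsetE => _ [->|/(forest_span sF) //].
by apply: sub_span; left.
Qed.

(** In the balanced case the forest is a basis. In the unbalanced case the apex is already spanned,
    so the rank is the one given by [rank_apex]. *)
Lemma rank_points S F f : spanning_forest S F f ->
  proj_rank (point_fset S) = #|` F| + ~~ `[< @balanced (Omega0 hX) S >].
Proof.
move=> sF; have [FS aF _ _ _] := sF.
have [bS|nbS] := pselect (@balanced (Omega0 hX) S).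
  rewrite asboolT //= addn0 (@proj_rank_basis _ _ (point_fset F)) ?point_fset_card //.
  - apply/fsubsetP => _ /imfsetP[e /= eF ->]; apply/imfsetP; exists e => //.
    exact: (fsubsetP FS).
  - rewrite point_fsetE; apply: proj_indepS (forest_indep aF).
    by move=> x; right.
  - by rewrite !point_fsetE; exact: (balanced_forest_span sF bS).
rewrite asboolF //= addn1 -(rank_apex sF) proj_rank_span1 // point_fsetE.
by apply: contrapT => S0; apply/nbS/balancedP.
Qed.

Lemma Omega0_biased : is_biased (Omega0 hX).
Proof.
move=> T tT c2; have [F [f sF]] := spanning_forest_ex T.
have cT := theta_forest_card tT sF.
set K := [fset C in _ | _]%fset in c2.
have KP C : C \in K -> [/\ (C `<=` T)%fset, is_circle C & ~ span (pts C) e0].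
  by rewrite !inE /= fpowersetE => /andP[CT /asboolP[cC [_ C0]]].
(* Two distinct balanced circles, ordered so that [C1] is not contained in [C2]. *)
have [C1 [C2 [C1K C2K [e1 e1C1 e1C2]]]] :
    exists C1 C2, [/\ C1 \in K, C2 \in K & exists2 e, e \in C1 & e \notin C2].
  have [C1 C1K] : exists C, C \in K by apply/fset0Pn; rewrite -cardfs_gt0 c2.
  have [C2] : exists C, C \in (K `\ C1)%fset.
    by apply/fset0Pn; rewrite -cardfs_gt0; move: c2; rewrite (cardfsD1 C1 K) C1K; case: #|` _|.
  rewrite in_fsetD1 => /andP[C21 C2K].
  have [s12|/fsubsetPn[e eC eC']] := boolP (C1 `<=` C2)%fset; last first.
    by exists C1, C2; split => //; exists e.
  have [s21|/fsubsetPn[e eC eC']] := boolP (C2 `<=` C1)%fset; last first.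
    by exists C2, C1; split => //; exists e.
  by move: C21; rewrite eqEfsubset s12 s21.
have [C1T cC1 C10] := KP _ C1K; have [C2T cC2 C20] := KP _ C2K.
have [e2 e2C2] : exists e, e \in C2.
  by case: cC2 => u [[|[e v] s] [// _ _ _ _ ->]]; exists e; rewrite !inE eqxx.
have e21 : e2 != e1 by apply: contraNneq e1C2 => <-.
(* If [T] spanned the apex, its rank would be one more than the size of [F]. But [C2], which avoids
   [e1], makes [e2] redundant, and then [C1] makes [e1] redundant, so [B] spans [T] with two edges
   fewer than [T], at most the size of [F]. *)
have bT : ~ span (pts T) e0.
  move=> T0; pose B := ((T `\ e1) `\ e2)%fset.
  have B2 : span (pts B) (pv e2).
    have := circle_span cC2 C20 e2C2; apply: spanS; apply: ptsS; apply/fsubsetP => a.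
    rewrite !inE => /andP[-> aC2]; rewrite (fsubsetP C2T) // andbT.
    by apply: contraNneq e1C2 => <-.
  have B1' : pts (T `\ e1)%fset `<=` span (pts B).
    move=> _ [a /= aT <-]; have [->//|ae2] := eqVneq a e2.
    by apply: sub_span; exists a => //=; rewrite in_fsetD1 ae2.
  have B1 : span (pts B) (pv e1).
    apply: span_sub B1' _ _; have := circle_span cC1 C10 e1C1.
    by apply: spanS; apply: ptsS; exact: fsetSD.
  have TB : pts T `<=` span (pts B).
    move=> _ [a /= aT <-]; have [->//|ae1] := eqVneq a e1.
    by apply: B1'; exists a => //=; rewrite in_fsetD1 ae1.
  have : proj_rank (point_fset T) <= #|` point_fset B|.
    by apply: proj_rank_le; rewrite !point_fsetE.
  rewrite point_fset_card (rank_points sF) asboolF; last by move/balancedP.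
  have e1T : e1 \in T by exact: (fsubsetP C1T).
  have e2T : e2 \in (T `\ e1)%fset by rewrite in_fsetD1 e21 (fsubsetP C2T).
  rewrite addn1 -ltnS -ltnS => /leq_trans; move: cT.
  by rewrite (cardfsD1 e1 T) e1T (cardfsD1 e2 (T `\ e1)%fset) e2T => cT /(_ _ cT); rewrite ltnn.
(* Now every circle in [T] is balanced, and the three formed by pairs of paths are distinct,
   contradicting the count of two. *)
have [u [v [s1 [s2 [s3 [uv [p1 p2 p3] [d12 d13 d23] ET]]]]]] := tT.
have inK C : is_circle C -> (C `<=` T)%fset -> C \in K.
  move=> cC CT; rewrite !inE /= fpowersetE CT /=; apply/asboolP; split => //.
  split; first exact: flat_span.
  by apply: contra_not bT; apply: spanS; exact: ptsS.
have first_edge s : is_path u v s -> exists e, e \in unzip1 s.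
  move=> /(path_neq_nil uv); case: s => // -[e w] s _.
  by exists e; rewrite mem_head.
have [a1 a1s] := first_edge _ p1; have [a2 a2s] := first_edge _ p2.
have [a3 a3s] := first_edge _ p3.
pose w12 := (walk_edges s1 `|` walk_edges s2)%fset.
pose w13 := (walk_edges s1 `|` walk_edges s3)%fset.
pose w23 := (walk_edges s2 `|` walk_edges s3)%fset.
have k12 : w12 \in K.
  apply: inK; first exact: theta_circle p1 p2 d12.
  by rewrite ET; exact: fsubsetUl.
have k13 : w13 \in K.
  apply: inK; first exact: theta_circle p1 p3 d13.
  by rewrite ET -fsetUA; apply: fsetUS; exact: fsubsetUr.
have k23 : w23 \in K.
  apply: inK; first exact: theta_circle p2 p3 d23.
  by rewrite ET -fsetUA; exact: fsubsetUr.
have n1 : w23 != w12.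
  by apply/eqP => /fsetP/(_ a1); rewrite !inE a1s (negbTE (d12.1 _ a1s)) (negbTE (d13.1 _ a1s)).
have n2 : w23 != w13.
  by apply/eqP => /fsetP/(_ a1); rewrite !inE a1s (negbTE (d12.1 _ a1s)) (negbTE (d13.1 _ a1s)).
have n3 : w13 != w12.
  apply/eqP => /fsetP/(_ a3); rewrite !inE a3s orbT => /esym/orP[] h.
    by move: (d13.1 _ h); rewrite a3s.
  by move: (d23.1 _ h); rewrite a3s.
move: c2; rewrite (cardfsD1 w12 K) k12 (cardfsD1 w13) in_fsetD1 n3 k13.
by rewrite (cardfsD1 w23) !in_fsetD1 n1 n2 k23.
Qed.

(** If [None] is in [S], the image contains the apex and [rank_apex] applies; otherwise
    [rank_points] does, and its correction term is that of [lift_rank]. *)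
Lemma ext_lift_rank (S : {fset option (edge G)}) :
  proj_rank [fset (if x is Some e then pv e else e0) | x in S]%fset =
  @lift_rank (Omega0 hX) S.
Proof.
rewrite /lift_rank; set E := @edge_part (Omega0 hX) S; set I := imfset _ _ _.
have EP e : (e \in E) = (Some e \in S).
  by rewrite !inE mem_pmap map_id.
have [F [f sF]] := spanning_forest_ex E.
rewrite (spanning_forest_rank sF).
have [NS|NS] := boolP (None \in S).
  rewrite asboolF; last by case.
  rewrite addn1 -(rank_apex sF); congr proj_rank; apply/fsetP => p.
  apply/imfsetP/fset1UP => /= [[[e|] xS ->]|[->|/imfsetP[e /= eE ->]]].
  - by right; apply/imfsetP; exists e => //=; rewrite EP.
  - by left.
  - by exists None.
  - by exists (Some e); rewrite -?EP.
have -> : `[< @balanced (Omega0 hX) E /\ true >] = `[< @balanced (Omega0 hX) E >].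
  by apply/asboolP/asboolP => [[]|].
rewrite -(rank_points sF); congr proj_rank; apply/fsetP => p.
apply/imfsetP/imfsetP => /= [[[e|] xS ->]|[e eE ->]].
- by exists e; rewrite ?EP.
- by rewrite xS in NS.
- by exists (Some e); rewrite -?EP.
Qed.

End Representation.

Theorem theorem3p1 (P : projGeom) (H : set P) (hypH : hyperplane H)
    (D : graph) (D_nonempty : inhabited (node D)) (D_simple : is_simple D)
    (z : edge D -> P) (zH : forall f : edge D, H (z f)) (z_repr : proj_repr z)
    (e0 : P) (e0H : ~ H e0)
    (Ehat : set P) (hE : Ehat `<=` edge_lines z e0 `\ e0) :
  is_biased (Omega0 hE) /\
  is_matroid (ext_lift_matroid (Omega0 hE)) /\
  matroid_iso (ext_lift_matroid (Omega0 hE)) (proj_matroid (e0 |` Ehat))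
    (fun x : option Ehat => if x is Some e then val e else e0).
Proof.
set phi := fun x => _.
have rkE (S : {fset option Ehat}) :
    proj_rank [fset phi x | x in S]%fset = rk (ext_lift_matroid (Omega0 hE)) S.
  exact: (ext_lift_rank hypH D_simple zH z_repr e0H).
have phiU1 x (S : {fset option Ehat}) :
    [fset phi y | y in (x |` S)%fset]%fset = (phi x |` [fset phi y | y in S])%fset.
  apply/fsetP => p; apply/imfsetP/fset1UP => /= [[y]|].
    rewrite !inE => /orP[/eqP -> ->|yS ->]; [by left|right].
    by apply/imfsetP; exists y.
  case=> [->|/imfsetP[y /= yS ->]]; first by exists x; rewrite // !inE eqxx.
  by exists y; rewrite // !inE yS orbT.
split; first exact: (Omega0_biased hypH D_simple zH z_repr e0H).
split.
  (* The rank axioms are pulled back along [phi] from the matroid of all points. *)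
  have [r0 rS] := proj_matroid_is_matroid (@setT P).
  split; first by rewrite -rkE (_ : imfset _ _ _ = fset0) // imfset0.
  move=> S _; have [|r1 r2] := rS [fset phi x | x in S]%fset; first by [].
  split=> [x _|x y _ _]; rewrite -!rkE !phiU1; first exact: r1.
  exact: r2.
split=> [|S _]; last exact: rkE.
(* No point of [Ehat] is the apex, so [None] does not collide with an edge under [phi]. *)
have valn (e : Ehat) : val e <> e0 by have [] := hE _ (set_mem (valP e)).
split.
- by move=> [e|] _; [right; exact: set_mem (valP e)|left].
- move=> [e|] [e'|] _ _ //=.
  + by move=> /val_inj ->.
  + by move/valn.
  + by move/esym/valn.
- move=> p [->|Ep]; first by exists None.
  by exists (Some (exist _ p (mem_set Ep))).
Qed.
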